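(* Let $C\subset\mathbb P^2$ be a plane curve of degree $d$ through $O$, smooth at $O$, and let $D\subset\mathbb P^2$ be a line. Then $\Delta_{C,s_+}=\Delta_{d,\frac sd,\frac1d}$ for every rational $s\ge d^2$. In particular, for such $s$, $$\Delta_{(C,O)}(D)=\Delta_{\frac1d,d}=\begin{pmatrix}0&1\\1&-s\end{pmatrix}\Delta_{C,s_+},$$ where the matrix acts on column vectors $(t,u)^T$.
   Context: Work over $\mathbb C$; $x=X/Z$, $y=Y/Z$, $O=(0,0)$; $C$ tangent to $\{y=0\}$ at $O$, locally $x\mapsto(x,\xi(x))$, $\xi\in\mathbb C[[x]]$, $\xi(0)=\xi'(0)=0$. For $f\ne0$ with $C$-expansion $f=\sum a_{ij}x^i(y-\xi(x))^j$, $v_1(C,s;f)=\min\{i+sj:a_{ij}\ne0\}$ and, for rational $s$, $v_+(C,s)(f)=(v_1(C,s;f),\min\{j:\exists i,\ a_{ij}\ne0,\ i+sj=v_1(C,s;f)\})$. $\Delta_{C,s_+}\subset\mathbb R^2$ (coordinates $(t,u)$) is the closure of the convex hull of $\{v_+(C,s)(F/Z^k)/k:k\ge1,\ F\ne0\text{ homogeneous of degree }k\}$. $\Delta_{(C,O)}(D)$ is the Newton–Okounkov body of the line class with respect to the flag $\mathbb P^2\supset C\supset O$, i.e. built in the same way from the flag valuation $\nu(\phi)=(\operatorname{ord}_C\phi,\operatorname{ord}_O((\phi/g^{\operatorname{ord}_C\phi})|_C))$, $g$ a local equation of $C$ at $O$. $\Delta_{a,b,c}$ is the triangle with vertices $(0,0),(a,0),(b,c)$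 and $\Delta_{a,c}=\Delta_{a,0,c}$. *)

(* Defs.v *)
From HB Require Import structures.
From mathcomp Require Import all_boot all_algebra.
From mathcomp Require Import mpoly.
From mathcomp Require Import complex.
From mathcomp Require Import Rstruct.

Set Implicit Arguments.
Unset Strict Implicit.
Unset Printing Implicit Defensive.
Import GRing.Theory Num.Theory.
Local Open Scope ring_scope.

Definition CC : numClosedFieldType := complex Rdefinitions.R.
Definition RR : rcfType := Rdefinitions.R.

Definition iX : 'I_3 := @Ordinal 3 0 isT.
Definition iY : 'I_3 := @Ordinal 3 1 isT.
Definition iZ : 'I_3 := @Ordinal 3 2 isT.

Definition ptO : 'I_3 -> CC := fun i => if i == iZ then 1 else 0.

Definition homog3 (k : nat) (F : {mpoly CC[3]}) : bool :=
  all (fun m : 'X_{1..3} => mdeg m == k) (msupp F).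

Definition mconst (A : {mpoly CC[3]}) : bool := (msize A <= 1)%N.

Definition mirreducible (G : {mpoly CC[3]}) : Prop :=
  ~~ mconst G /\ forall A B : {mpoly CC[3]}, G = A * B -> mconst A \/ mconst B.

(* Formal power series in x, as coefficient sequences. *)
Definition ps := nat -> CC.
Definition ps1 : ps := fun n => if n == 0%N then 1 else 0.
Definition psmul (a b : ps) : ps := fun n => \sum_(i < n.+1) a i * b (n - i)%N.
Definition psexp (a : ps) (n : nat) : ps := iter n (psmul a) ps1.

(* C-expansion: for F homogeneous (of any degree k), the coefficient a_ij in
   F/Z^k = F(x,y,1) = sum_{i,j} a_ij x^i (y - xi(x))^j.  Writing
   F = sum_m c_m X^m0 Y^m1 Z^m2, F/Z^k = sum_m c_m x^m0 ((y-xi) + xi)^m1, so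
   a_ij = sum_m c_m binom(m1,j) [x^(i-m0)] xi^(m1-j). *)
Definition expand (xi : ps) (F : {mpoly CC[3]}) (i j : nat) : CC :=
  \sum_(m <- msupp F)
     F@_m * ('C(m iY, j))%:R *
     (if (m iX <= i)%N then psexp xi (m iY - j) (i - m iX)%N else 0).

(* (i,j) realizes v_+(C,s)(F/Z^k): a_ij <> 0, i + s j is minimal among the
   nonzero coefficients and j is minimal among those achieving it.  Then
   v_+(C,s)(F/Z^k) = (i + s j, j). *)
Definition vplus_at (xi : ps) (s : rat) (F : {mpoly CC[3]}) (i j : nat) : Prop :=
  expand xi F i j != 0 /\
  forall i' j' : nat, expand xi F i' j' != 0 ->
    (i%:Q + s * j%:Q <= i'%:Q + s * j'%:Q) /\
    (i'%:Q + s * j'%:Q = i%:Q + s * j%:Q -> (j <= j')%N).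

Definition ps_ord (h : ps) (o : nat) : Prop :=
  h o != 0 /\ forall i, (i < o)%N -> h i = 0.

Definition set2 := RR * RR -> Prop.

Definition conv_hull (S : set2) : set2 := fun p =>
  exists (n : nat) (w : 'I_n -> RR) (q : 'I_n -> RR * RR),
    (forall i, 0 <= w i) /\ \sum_(i < n) w i = 1 /\ (forall i, S (q i)) /\
    p = (\sum_(i < n) w i * (q i).1, \sum_(i < n) w i * (q i).2).

Definition closure2 (S : set2) : set2 := fun p =>
  forall e : RR, 0 < e -> exists q, S q /\ `|p.1 - q.1| < e /\ `|p.2 - q.2| < e.

Definition seteq2 (A B : set2) : Prop := forall p, A p <-> B p.

Definition triangle (a b c : RR) : set2 :=
  conv_hull (fun p => p = (0, 0) \/ p = (a, 0) \/ p = (b, c)).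

Definition matimg (a b c e : RR) (S : set2) : set2 := fun p =>
  exists q, S q /\ p = (a * q.1 + b * q.2, c * q.1 + e * q.2).

Definition DeltaCs (xi : ps) (s : rat) : set2 :=
  closure2 (conv_hull (fun p =>
    exists (k : nat) (F : {mpoly CC[3]}) (i j : nat),
      (0 < k)%N /\ homog3 k F /\ F != 0 /\ vplus_at xi s F i j /\
      p = (ratr (i%:Q + s * j%:Q) / k%:R, j%:R / k%:R))).

(* Flag valuation nu(F/Z^k) = (ord_C, ord_O((F/Z^k / g^ord_C)|_C)) with C = {G = 0},
   local equation g = G/Z^d, O-order computed via the parametrization x |-> (x, xi x). *)
Definition nu_at (G : {mpoly CC[3]}) (xi : ps) (F : {mpoly CC[3]}) (m o : nat) : Prop :=
  exists H : {mpoly CC[3]},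
    F = G ^+ m * H /\ ~ (exists Q, H = G * Q) /\ ps_ord (fun i => expand xi H i 0) o.

(* Delta_{(C,O)}(D), D a line (class of O(1)). *)
Definition DeltaNO (G : {mpoly CC[3]}) (xi : ps) : set2 :=
  closure2 (conv_hull (fun p =>
    exists (k : nat) (F : {mpoly CC[3]}) (m o : nat),
      (0 < k)%N /\ homog3 k F /\ F != 0 /\ nu_at G xi F m o /\
      p = (m%:R / k%:R, o%:R / k%:R))).

(* Main.v *)
Require Import Defs.
From HB Require Import structures.
From mathcomp Require Import all_boot all_order all_algebra.
From mathcomp Require Import mpoly.
From mathcomp Require Import complex.
From mathcomp Require Import Rstruct.
From mathcomp Require Import ring lra zify.
From Stdlib Require Import Classical.
Set Implicit Arguments.
Unset Strict Implicit.
Unset Printing Implicit Defensive.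
Import Order.TTheory GRing.Theory Num.Theory.
Local Open Scope ring_scope.

(** Let [F] be a form of degree [k] and write [F = G ^+ m * H] with [G] not
    dividing [H].  Bezout bounds the order [o] of [H] along [C] at [O] by
    [d * (k - d * m)], and the coefficient of index [(o, m)] in the
    [C]-expansion of [F] is the first nonzero one in its row, all rows below [m]
    being zero.  Hence for [s >= d ^ 2] both [(o, m)] and the index realizing
    [v_+(C, s)] lie in [A k = {(i, j) | i + d ^ 2 * j <= d * k}].  Scaled by
    [1 / k], such indices fill the triangle with vertices [(0, 0)], [(d, 0)] and
    [(0, 1 / d)], of which the two bodies are linear images.  The first and last
    vertices come from [Z] and [G].  For the second one, [A k] has only [O(k)]
    more points than the dimension of the space of forms, so a nonzero form can
    be made to vanish at all indices of [A k] outside a small neighbourhood of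
    [(d * k, 0)].

    The local form of Bezout is a dimension count as well: if [H] vanished along
    [C] to order [> d * e], then the forms [A * G + B * H] and
    [X ^+ i * Z ^+ (n - i)], [i <= d * e], would span too much.  The only
    arithmetic input is that the forms vanishing along [C] are the multiples of
    [G]: they dehomogenize to a prime ideal of [K[x][y]] meeting [K[x]] in [0],
    and pseudo-division by a primitive element of least degree in [y] shows that
    such an ideal is principal. *)

Lemma exists_minimizer (T : Type) (P : T -> Prop) (f : T -> nat) x : P x ->
  exists2 y, P y & forall z, P z -> (f y <= f z)%N.
Proof.
have [n] := ubnP (f x); elim: n x => // n IHn x lt_fx Px.
have [min_x|nmin_x] := classic (forall z, P z -> (f x <= f z)%N); first by exists x.
have [z /(imply_to_and (P z))[Pz /negP]] := not_all_ex_not _ _ nmin_x.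
rewrite -ltnNge => lt_fz.
exact: (IHn z (leq_trans lt_fz lt_fx)).
Qed.

Section LinearAlgebra.
Variable K : fieldType.

Lemma dim_leq_ker (U W : vectType K) (L : {linear U -> W}) :
  (dim U <= \dim (lker (linfun L)) + dim W)%N.
Proof.
have := limg_ker_dim (linfun L) fullv; rewrite capfv dimvf => <-.
by rewrite leq_add2l (leq_trans (dimvS (subvf _))) // dimvf.
Qed.

Lemma dim_leq_exact (T U W : vectType K) (M : {linear T -> U}) (L : {linear U -> W}) :
  (forall u, L u = 0 -> exists t, u = M t) -> (dim U <= dim T + dim W)%N.
Proof.
move=> exactML; apply: leq_trans (dim_leq_ker L) _; rewrite leq_add2r.
have /dimvS/leq_trans : (lker (linfun L) <= limg (linfun M))%VS.
  apply/subvP => u; rewrite memv_ker lfunE /= => /eqP/exactML[t ->].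
  by rewrite -(lfunE M) memv_img ?memvf.
apply; have := limg_ker_dim (linfun M) fullv; rewrite [X in _ = X]dimvf => <-.
exact: leq_addl.
Qed.

Lemma common_zero (V : vectType K) (I : eqType) (r : seq I) (f : I -> V -> K) :
    (forall i, scalar (f i)) -> (size r < dim V)%N ->
  exists2 v : V, v != 0 & {in r, forall i, f i v = 0}.
Proof.
move=> f_lin lt_r; pose L (v : V) := \row_(l < size r) f (tnth (in_tuple r) l) v.
have L_lin : linear L by move=> c u v; apply/rowP => l; rewrite !mxE f_lin.
pose LL : {linear V -> 'rV[K]_(size r)} := HB.pack L (GRing.isLinear.Build _ _ _ _ L L_lin).
have : (0 < \dim (lker (linfun LL)))%N.
  rewrite -(ltn_add2r (size r)) add0n; apply: leq_trans lt_r _.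
  have dim_rV : dim 'rV[K]_(size r) = size r by exact: mul1n.
  by rewrite -[X in (_ <= _ + X)%N]dim_rV; exact: dim_leq_ker.
rewrite lt0n dimv_eq0 -vpick0 => nz; exists (vpick (lker (linfun LL))) => // i ri.
have := memv_pick (lker (linfun LL)); rewrite memv_ker lfunE => /eqP.
have lt_i : (index i r < size r)%N by rewrite index_mem.
by move/rowP/(_ (Ordinal lt_i)); rewrite !mxE (tnth_nth i) /= nth_index.
Qed.

End LinearAlgebra.

(** * Prime ideals of [K[x][y]] *)

Section PrimitivePolynomials.
Variable K : closedFieldType.
Implicit Types (f g h q : {poly {poly K}}) (c : {poly K}).

(* Over a closed field a nonconstant content has a linear factor. *)
Definition primitive f := forall a : K, map_poly (horner_eval a) f != 0.

Lemma map_horner_eval_eq0 f a : map_poly (horner_eval a) f = 0 ->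
  exists f', f = ('X - a%:P) *: f'.
Proof.
move=> fa0; exists (map_poly (fun c => c %/ ('X - a%:P)) f).
apply/polyP => j; rewrite coefZ coef_map_id0 ?div0p // mulrC divpK //.
have := congr1 (fun p : {poly K} => p`_j) fa0.
by rewrite coef_map coef0 /= /horner_eval => fja; rewrite dvdp_XsubCl rootE fja.
Qed.

Lemma primitive_factor f : f != 0 ->
  exists c f', [/\ c != 0, f = c *: f' & primitive f'].
Proof.
have [n] := ubnP (size (lead_coef f)); elim: n f => // n IHn f lt_f nz_f.
have [prim_f|nprim_f] := classic (primitive f).
  by exists 1, f; rewrite oner_neq0 scale1r.
have [a /negP/negPn/eqP/map_horner_eval_eq0[f1 fE]] := not_all_ex_not _ _ nprim_f.
have nz_Xa : 'X - a%:P != 0 :> {poly K} by rewrite polyXsubC_eq0.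
have nz_f1 : f1 != 0 by apply: contraNneq nz_f => f10; rewrite fE f10 scaler0.
have lt_f1 : (size (lead_coef f1) < n)%N.
  move: lt_f; rewrite fE lead_coefZ size_mul ?lead_coef_eq0 // size_XsubC.
  by rewrite add2n /= ltnS.
have [c [f' [nz_c f1E prim_f']]] := IHn _ lt_f1 nz_f1.
exists (('X - a%:P) * c), f'; split; [by rewrite mulf_neq0| |by []].
by rewrite fE f1E scalerA.
Qed.

Lemma primitive_dvd_scale c f h q : primitive f -> c != 0 ->
  c *: h = q * f -> exists q', h = q' * f.
Proof.
move=> prim_f; have [n] := ubnP (size c).
elim: n c q => // n IHn c q lt_c nz_c chE.
have [/eqP/size_poly1P[u nz_u cE]|/closed_rootP[a]] := eqVneq (size c) 1.
  exists (u^-1%:P *: q); rewrite -scalerAl -chE cE scalerA -polyCM.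
  by rewrite mulVf // scale1r.
rewrite -dvdp_XsubCl => /dvdpP[c' cE].
have nz_c' : c' != 0 by apply: contraNneq nz_c => c'0; rewrite cE c'0 mul0r.
have qa0 : map_poly (horner_eval a) q = 0.
  have /eqP := congr1 (map_poly (horner_eval a)) chE.
  rewrite rmorphM /= map_polyZ cE /= [horner_eval a _]hornerM hornerXsubC subrr.
  by rewrite mulr0 scale0r eq_sym mulf_eq0 (negPf (prim_f a)) orbF => /eqP.
have [q' qE] := map_horner_eval_eq0 qa0.
apply: (IHn c' q') => //.
  by move: lt_c; rewrite cE size_mul ?polyXsubC_eq0 // size_XsubC addn2 /= ltnS.
have nz_Xa : ('X - a%:P)%:P != 0 :> {poly {poly K}} by rewrite polyC_eq0 polyXsubC_eq0.
by apply: (mulfI nz_Xa); rewrite !mul_polyC scalerA mulrC -cE chE qE -scalerAl.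
Qed.

Variable I : {poly {poly K}} -> Prop.
Hypotheses (I_comb : forall p q f g, I f -> I g -> I (p * f + q * g))
  (I_prime : forall p q, I (p * q) -> I p \/ I q)
  (I_polyC : forall c, I c%:P -> c = 0).

Lemma prime_ideal_principal g : I g -> g != 0 ->
  exists2 f, I f /\ f != 0 & forall h, I h -> exists q, h = q * f.
Proof.
move=> Ig nz_g.
have [g1 [Ig1 nz_g1] g1_min] :=
  @exists_minimizer _ (fun f => I f /\ f != 0) (fun f => size f) g (conj Ig nz_g).
have [c [f [nz_c g1E prim_f]]] := primitive_factor nz_g1.
have nz_f : f != 0 by apply: contraNneq nz_g1 => f0; rewrite g1E f0 scaler0.
have If : I f.
  have := Ig1; rewrite g1E -mul_polyC => /I_prime[/I_polyC c0|//].
  by rewrite c0 eqxx in nz_c.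
exists f => // h Ih; have hE := Pdiv.Idomain.divp_eq h f.
have rem0 : h %% f = 0.
  apply/eqP/negPn/negP => nz_rem.
  have Irem : I (h %% f).
    rewrite (_ : h %% f = (lead_coef f ^+ scalp h f)%:P * h + (- (h %/ f)) * f).
      exact: I_comb.
    by rewrite mul_polyC hE; ring.
  have := g1_min _ (conj Irem nz_rem).
  by rewrite g1E size_scale // leqNgt Pdiv.Idomain.ltn_modpN0.
apply: (primitive_dvd_scale (q := h %/ f) prim_f _ (etrans hE _)).
  by rewrite expf_neq0 // lead_coef_eq0.
by rewrite rem0 addr0.
Qed.

Lemma irreducible_generates_prime_ideal g : I g -> g != 0 ->
    (forall p q, g = p * q -> (exists a, p = a%:P%:P) \/ (exists a, q = a%:P%:P)) ->
  forall h, I h -> exists q, h = q * g.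
Proof.
move=> Ig nz_g irr_g h Ih.
have [f [If nz_f] f_gen] := prime_ideal_principal Ig nz_g.
have [u gE] := f_gen g Ig.
have [[a uE]|[a fE]] := irr_g _ _ gE; last first.
  by move: nz_f; rewrite fE (I_polyC (c := a%:P)) ?eqxx // -fE.
have nz_a : a != 0 by apply: contraNneq nz_g => a0; rewrite gE uE a0 !mul0r.
have [q ->] := f_gen h Ih; exists (q * a^-1%:P%:P).
by rewrite gE uE mulrA -(mulrA q) -!polyCM mulVf // mulr1.
Qed.

End PrimitivePolynomials.

(** * Homogeneous polynomials *)

Section HomogeneousFactors.
Variables (n : nat) (R : idomainType).
Implicit Types F P Q : {mpoly R[n]}.

Definition mdvd P F : Prop := exists Q, F = P * Q.

Lemma dhomogM_deg e b k P Q : (e + b = k)%N ->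
  P \is e.-homog -> Q \is b.-homog -> P * Q \is k.-homog.
Proof. by move=> <-; exact: dhomogM. Qed.

Lemma pihomogMl e b P Q : P \is e.-homog ->
  pihomog mdeg (e + b) (P * Q) = P * pihomog mdeg b Q.
Proof.
move=> homP; pose k := maxn (msize Q) b.+1.
rewrite {1}(@pihomog_partitionE _ _ mdeg k Q) ?leq_maxl // mulr_sumr linear_sum /=.
have lt_bk : (b < k)%N by rewrite leq_max leqnn orbT.
rewrite (bigD1 (Ordinal lt_bk)) //= pihomog_dE; last exact: dhomogM (pihomogP _ _ _).
rewrite big1 ?addr0 // => i; rewrite -val_eqE /= => ne_ib.
apply: (@pihomog_ne0 _ _ _ (e + i)); first by rewrite eqn_add2l.
exact: dhomogM (pihomogP _ _ _).
Qed.

Lemma dhomog_msizeE e P : P != 0 -> P \is e.-homog -> msize P = e.+1.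
Proof. by move=> nz_P homP; rewrite -mlead_deg // (dhomog_mf homP (mlead_supp nz_P)). Qed.

Lemma dhomog_cofactor k e F P Q : F != 0 -> F \is k.-homog -> P \is e.-homog ->
  F = P * Q -> (e <= k)%N /\ Q \is (k - e).-homog.
Proof.
move=> nz_F homF homP FE.
have /norP[nz_P nz_Q] : ~~ ((P == 0) || (Q == 0)) by rewrite -mulf_eq0 -FE.
have le_ek : (e <= k)%N.
  have := dhomog_msizeE nz_F homF; rewrite FE msizeM // (dhomog_msizeE nz_P homP).
  by move=> /= sizeE; rewrite -ltnS -sizeE -addn1 leq_add2l lt0n msize_poly_eq0.
split=> //; rewrite homog_piE; apply/eqP/(mulfI nz_P).
by rewrite -(pihomogMl _ _ homP) subnKC // -FE pihomog_dE.
Qed.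

End HomogeneousFactors.

(** * Dehomogenization *)

Lemma big_ord3 (T : Type) (idx : T) (op : Monoid.law idx) (F : 'I_3 -> T) :
  \big[op/idx]_(i < 3) F i = op (op (F iX) (F iY)) (F iZ).
Proof.
rewrite !big_ord_recl big_ord0 Monoid.mulm1 Monoid.mulmA.
by congr (op (op (F _) (F _)) (F _)); apply: val_inj.
Qed.

Lemma mdeg3 (m : 'X_{1..3}) : mdeg m = (m iX + m iY + m iZ)%N.
Proof. by rewrite mdegE big_ord3. Qed.

Section Dehomogenization.
Variable R : idomainType.
Implicit Types (F P : {mpoly R[3]}) (p q : {poly {poly R}}).

Definition affine_chart (i : 'I_3) : {poly {poly R}} :=
  if i == iX then 'X%:P else if i == iY then 'X else 1.

Definition dehom : {mpoly R[3]} -> {poly {poly R}} :=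
  mmap (polyC \o polyC) affine_chart.

HB.instance Definition _ := GRing.RMorphism.copy dehom
  (mmap ((@polyC {poly R}) \o (@polyC R)) affine_chart).

Definition mpolyXY : {poly {poly R}} -> {mpoly R[3]} :=
  horner_morph (fun c => mulrC 'X_iY (horner_alg 'X_iX c)).

HB.instance Definition _ := GRing.RMorphism.copy mpolyXY
  (horner_morph (fun c => mulrC 'X_iY (horner_alg ('X_iX : {mpoly R[3]}) c))).

Lemma dehomC c : dehom c%:MP = c%:P%:P.
Proof. exact: mmapC. Qed.

Lemma dehomX i : dehom 'X_i = affine_chart i.
Proof. by rewrite /dehom mmapX mmap1U. Qed.

Lemma dehom_mul_varZ F n : dehom (F * 'X_iZ ^+ n) = dehom F.
Proof. by rewrite rmorphM rmorphXn /= dehomX expr1n mulr1. Qed.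

Lemma dehomE F :
  dehom F = \sum_(m <- msupp F) (F@_m)%:P%:P * ('X^(m iX)%:P * 'X^(m iY)).
Proof.
apply: eq_bigr => m _; rewrite /mmap1 big_ord3 /affine_chart /= expr1n mulr1.
by rewrite polyC_exp.
Qed.

Lemma mpolyXY_polyC (c : {poly R}) : mpolyXY c%:P = horner_alg 'X_iX c.
Proof. exact: horner_morphC. Qed.

Lemma mpolyXY_X : mpolyXY 'X = 'X_iY.
Proof. exact: horner_morphX. Qed.

Lemma mpolyXYK : cancel mpolyXY dehom.
Proof.
elim/poly_ind => [|p c IHp]; first by rewrite !rmorph0.
rewrite !(rmorphD, rmorphM) /= IHp mpolyXY_X dehomX mpolyXY_polyC; congr (_ + _).
elim/poly_ind: c => [|c a IHc]; first by rewrite !rmorph0.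
rewrite !(rmorphD, rmorphM) /= IHc horner_algX horner_algC dehomX.
by rewrite -mul_mpolyC mulr1 dehomC.
Qed.

Lemma mpolyXY_dehom F :
  mpolyXY (dehom F) = \sum_(m <- msupp F) F@_m *: ('X_iX ^+ m iX * 'X_iY ^+ m iY).
Proof.
rewrite dehomE rmorph_sum; apply: eq_bigr => m _.
rewrite !rmorphM /= !mpolyXY_polyC !rmorphXn /= mpolyXY_X horner_algX.
by rewrite horner_algC mulr_algl.
Qed.

Lemma dhomog_varXn i n : ('X_i ^+ n : {mpoly R[3]}) \is n.-homog.
Proof. by rewrite mpolyXn dhomogX /= mdegMn mdeg1 mul1n. Qed.

Lemma dhomog_monomXY a b : ('X_iX ^+ a * 'X_iY ^+ b : {mpoly R[3]}) \is (a + b).-homog.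
Proof. exact: dhomogM (dhomog_varXn _ _) (dhomog_varXn _ _). Qed.

Lemma msize_mpolyXY_dehom F : (msize (mpolyXY (dehom F)) <= msize F)%N.
Proof.
rewrite mpolyXY_dehom; apply: leq_trans (msize_sum _ _ _) _.
apply/bigmax_leqP_seq => m m_supp _; apply: leq_trans (msizeZ_le _ _) _.
rewrite !mpolyXn -mpolyXD msizeX mdegD !mdegMn !mdeg1 !mul1n.
by apply: leq_ltn_trans (msize_mdeg_lt m_supp); rewrite mdeg3 leq_addr.
Qed.

Definition homogenize (n : nat) F : {mpoly R[3]} :=
  \sum_(i < n.+1) pihomog mdeg i F * 'X_iZ ^+ (n - i).

Lemma homogenize_is_linear n : linear (homogenize n).
Proof.
move=> c F P; rewrite /homogenize scaler_sumr -big_split; apply: eq_bigr => i _.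
by rewrite linearP mulrDl scalerAl.
Qed.

HB.instance Definition _ n :=
  GRing.isLinear.Build R {mpoly R[3]} {mpoly R[3]} _ _ (homogenize_is_linear n).

Lemma homogenize_homog n F : homogenize n F \is n.-homog.
Proof.
apply: rpred_sum => i _; apply: dhomogM_deg (pihomogP _ _ _) (dhomog_varXn _ _).
by rewrite subnKC // -ltnS.
Qed.

Lemma dehom_homogenize n F : (msize F <= n.+1)%N -> dehom (homogenize n F) = dehom F.
Proof.
move=> /(pihomog_partitionE (mf := mdeg)) {2}->; rewrite !rmorph_sum.
by apply: eq_bigr => i _; exact: dehom_mul_varZ.
Qed.

Lemma homogenize_dhomog n e F : (e <= n)%N -> F \is e.-homog ->
  homogenize n F = F * 'X_iZ ^+ (n - e).
Proof.
move=> le_en homF; rewrite /homogenize (bigD1 (Ordinal (le_en : e < n.+1)%N)) //=.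
rewrite pihomog_dE // big1 ?addr0 // => i; rewrite -val_eqE /= => ne_ie.
by rewrite (pihomog_ne0 (d := e)) ?mul0r // eq_sym.
Qed.

Lemma homogenize_dehom n F : F \is n.-homog -> homogenize n (mpolyXY (dehom F)) = F.
Proof.
move=> homF; rewrite [RHS]mpolyE mpolyXY_dehom linear_sum.
apply: eq_big_seq => m m_supp.
have degm : mdeg m = n := dhomog_mf homF m_supp; rewrite mdeg3 in degm.
rewrite linearZ /= (homogenize_dhomog _ (dhomog_monomXY _ _)); last first.
  by rewrite -degm leq_addr.
by rewrite -degm addKn [in RHS]mpolyXE_id big_ord3.
Qed.

Lemma dehom_homog_inj n : {in n.-homog &, injective dehom}.
Proof.
move=> F P homF homP eqFP.
by rewrite -(homogenize_dehom homF) eqFP homogenize_dehom.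
Qed.

Lemma dehom_homog_eq0 n F : F \is n.-homog -> (dehom F == 0) = (F == 0).
Proof.
move=> homF; apply/eqP/eqP => [F0|->]; last by rewrite rmorph0.
by apply: (dehom_homog_inj homF); rewrite ?rpred0 // F0 rmorph0.
Qed.

(* The factors of [dehom F] have total degrees adding up to at most [n]. *)
Lemma dehom_factor_lift n F p q : F \is n.-homog -> F != 0 -> dehom F = p * q ->
  exists e P Q, [/\ P \is e.-homog, F = P * Q, dehom P = p & dehom Q = q].
Proof.
move=> homF nz_F FE; set sizeXY := fun p => msize (mpolyXY p).
have /norP[nz_p nz_q] : ~~ ((p == 0) || (q == 0)).
  by rewrite -mulf_eq0 -FE (dehom_homog_eq0 homF).
have nz_XY r : r != 0 -> mpolyXY r != 0.
  by apply: contra_neq => r0; rewrite -[r]mpolyXYK r0 rmorph0.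
have le_size : ((sizeXY p + sizeXY q).-1 <= n.+1)%N.
  rewrite -msizeM ?nz_XY // -rmorphM -FE; apply: leq_trans (msize_mpolyXY_dehom _) _.
  rewrite msizeE; apply/bigmax_leqP_seq => m m_supp _.
  by rewrite (dhomog_mf homF m_supp).
have size_gt0 r : r != 0 -> (0 < sizeXY r)%N by rewrite lt0n msize_poly_eq0; exact: nz_XY.
have := size_gt0 p nz_p; have := size_gt0 q nz_q => gt0_q gt0_p.
pose e := (sizeXY p).-1; have le_en : (e <= n)%N by rewrite /e; lia.
have EP : dehom (homogenize e (mpolyXY p)) = p.
  by rewrite dehom_homogenize ?mpolyXYK // /e -/(sizeXY p); lia.
have EQ : dehom (homogenize (n - e) (mpolyXY q)) = q.
  by rewrite dehom_homogenize ?mpolyXYK // /e -/(sizeXY q); lia.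
exists e, (homogenize e (mpolyXY p)), (homogenize (n - e) (mpolyXY q)).
split=> //; first exact: homogenize_homog.
apply: (dehom_homog_inj homF); last by rewrite rmorphM /= EP EQ.
exact: dhomogM_deg (subnKC le_en) (homogenize_homog _ _) (homogenize_homog _ _).
Qed.

End Dehomogenization.

(** * Irreducible forms *)

Lemma mirreducible_neq0 (G : {mpoly CC[3]}) : mirreducible G -> G != 0.
Proof. by case=> ncst_G _; apply: contraNneq ncst_G => ->; rewrite /mconst msize0. Qed.

Section IrreducibleForm.
Variables (d : nat) (G : {mpoly CC[3]}).
Hypotheses (homG : G \is d.-homog) (irrG : mirreducible G) (GO : G.@[ptO] = 0).

Lemma dehom_irreducible (p q : {poly {poly CC}}) : dehom G = p * q ->
  (exists a, p = a%:P%:P) \/ (exists a, q = a%:P%:P).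
Proof.
move=> /(dehom_factor_lift homG (mirreducible_neq0 irrG))[e [P [Q [_ GE <- <-]]]].
have dehom_cst A : mconst A -> exists a, dehom A = a%:P%:P.
  by move=> /msize1_polyC ->; rewrite dehomC; exists A@_0.
by case: irrG => _ /(_ _ _ GE) [/dehom_cst|/dehom_cst]; [left|right].
Qed.

Lemma irreducible_varZ_ndvd P : G <> P * 'X_iZ.
Proof.
move=> GE; case: irrG => _ /(_ _ _ GE) [/msize1_polyC PE|]; last first.
  by rewrite /mconst msizeX mdeg1.
have := GO; rewrite GE PE rmorphM /= mevalC mevalXU /ptO eqxx mulr1 => c0.
by have := mirreducible_neq0 irrG; rewrite GE PE c0 mpolyC0 mul0r eqxx.
Qed.

Lemma dvd_of_dehom n F (q : {poly {poly CC}}) : F \is n.-homog -> dehom F = q * dehom G ->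
  mdvd G F.
Proof.
move=> homF; have [->|nz_F] := eqVneq F 0; first by exists 0; rewrite mulr0.
rewrite mulrC => /(dehom_factor_lift homF nz_F)[e [P [Q [homP -> EP _]]]].
have [le_de|lt_ed] := leqP d e.
  exists ('X_iZ ^+ (e - d) * Q); rewrite mulrA; congr (_ * _).
  apply: (dehom_homog_inj homP); last by rewrite dehom_mul_varZ.
  exact: dhomogM_deg (subnKC le_de) homG (dhomog_varXn _ _ _).
case: (@irreducible_varZ_ndvd (P * 'X_iZ ^+ (d - e).-1)).
rewrite -mulrA -exprSr prednK ?subn_gt0 //.
apply: (dehom_homog_inj homG); last by rewrite [RHS]dehom_mul_varZ; exact/esym/EP.
exact: dhomogM_deg (subnKC (ltnW lt_ed)) homP (dhomog_varXn _ _ _).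
Qed.

End IrreducibleForm.

(** * The expansion along the branch *)

Lemma coef_XaddC_exp (R : comNzRingType) (c : R) n j :
  (('X + c%:P) ^+ n)`_j = c ^+ (n - j) *+ 'C(n, j).
Proof.
have -> : ('X + c%:P) ^+ n = \poly_(i < n.+1) (c ^+ (n - i) *+ 'C(n, i)).
  rewrite addrC exprDn poly_def; apply: eq_bigr => i _.
  by rewrite -polyC_exp mul_polyC scalerMnl.
by rewrite coef_poly ltnS; case: leqP => // /bin_small ->.
Qed.

Definition ps_trunc (N : nat) (xi : ps) : {poly CC} := \poly_(i < N) xi i.

Lemma psexp_trunc xi N n i : (i < N)%N -> psexp xi n i = (ps_trunc N xi ^+ n)`_i.
Proof.
elim: n i => [|n IHn] i lt_iN; first by rewrite expr0 coef1 /psexp /= /ps1; case: eqP.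
rewrite exprS coefM /psexp iterS /psmul; apply: eq_bigr => a _.
have lt_aN : (a < N)%N by have := ltn_ord a; lia.
by rewrite coef_poly lt_aN; congr (_ * _); apply: IHn; lia.
Qed.

Lemma expand_dehom xi N F i j : (i < N)%N ->
  expand xi F i j = (dehom F \Po ('X + (ps_trunc N xi)%:P))`_j`_i.
Proof.
move=> lt_iN; rewrite dehomE rmorph_sum /= !coef_sum; apply: eq_bigr => m _.
rewrite !comp_polyM !comp_polyC (rmorphXn (comp_poly _)) /= comp_polyX -mulrA.
rewrite !coefCM coef_XaddC_exp.
rewrite mulrnAr coefMn coefXnM -[in RHS]mulr_natl ltnNge; congr (_ * (_ * _)).
by case: leqP => //= _; apply: psexp_trunc; lia.
Qed.

Lemma eq_expand_dehom xi F H i j :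
  dehom F = dehom H -> expand xi F i j = expand xi H i j.
Proof.
move=> eqFH.
by rewrite (expand_dehom xi F j (ltnSn i)) (expand_dehom xi H j (ltnSn i)) eqFH.
Qed.

Lemma expand_linear xi c F H i j :
  expand xi (c *: F + H) i j = c * expand xi F i j + expand xi H i j.
Proof.
rewrite !(@expand_dehom _ i.+1) // rmorphD /= -mul_mpolyC rmorphM /= dehomC.
by rewrite comp_polyD comp_polyM comp_polyC !coefD !coefCM.
Qed.

Lemma expand0 xi i j : expand xi 0 i j = 0.
Proof. by rewrite /expand msupp0 big_nil. Qed.

Lemma expandD xi F H i j : expand xi (F + H) i j = expand xi F i j + expand xi H i j.
Proof. by rewrite -[F]scale1r expand_linear mul1r scale1r. Qed.

Lemma expandZ xi c F i j : expand xi (c *: F) i j = c * expand xi F i j.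
Proof. by rewrite -[c *: F]addr0 expand_linear expand0 addr0. Qed.

Lemma expandM xi F H i j : expand xi (F * H) i j =
  \sum_(b < j.+1) \sum_(a < i.+1) expand xi F a b * expand xi H (i - a) (j - b).
Proof.
rewrite (@expand_dehom _ i.+1) // rmorphM comp_polyM coefM coef_sum.
apply: eq_bigr => b _; rewrite coefM; apply: eq_bigr => a _.
by rewrite -!(@expand_dehom _ i.+1) //; have := ltn_ord a; lia.
Qed.

Lemma expand_mpolyXY_polyC xi (c : {poly CC}) i j :
  expand xi (mpolyXY c%:P) i j = if j == 0%N then c`_i else 0.
Proof.
rewrite (@expand_dehom _ i.+1) // mpolyXYK comp_polyC coefC.
by case: eqP => // _; rewrite coef0.
Qed.

Lemma expand_XZ xi a b i j :
  expand xi ('X_iX ^+ a * 'X_iZ ^+ b) i j = ((i == a) && (j == 0))%:R.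
Proof.
rewrite -[RHS](_ : expand xi (mpolyXY ('X^a)%:P) i j = _); last first.
  by rewrite expand_mpolyXY_polyC coefXn; case: eqP; rewrite ?andbF ?andbT.
apply: eq_expand_dehom; rewrite mpolyXYK dehom_mul_varZ rmorphXn /= dehomX.
by rewrite -polyC_exp.
Qed.

Lemma expand_varZ xi i j : expand xi 'X_iZ i j = ((i == 0) && (j == 0))%:R.
Proof. by rewrite -[RHS](expand_XZ xi 0 1) mul1r. Qed.

Lemma psexp_coef0 xi n : psexp xi n 0 = xi 0%N ^+ n.
Proof.
elim: n => [|n IHn] //; rewrite exprS -IHn.
by rewrite {1}/psexp iterS /psmul big_ord1 subn0.
Qed.

Lemma expand_mderivY xi F : xi 0%N = 0 -> expand xi F 0 1 = (mderiv iY F).@[ptO].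
Proof.
move=> xi0; rewrite [mderiv iY F]/mderiv raddf_sum /=; apply: eq_bigr => m _.
rewrite mevalZ mevalX bin1 [_ * F@_m]mulrC; congr (_ * _).
rewrite big_ord3 !mnmBE !mnm1E /ptO /= expr1n mulr1 subn0 leqn0.
by case: (m iX) => [|n] /=; rewrite ?psexp_coef0 ?xi0 ?expr0 ?mul1r // exprS !mul0r.
Qed.

Lemma ps_ord_exists (h : ps) i : h i != 0 -> exists2 o, ps_ord h o & (o <= i)%N.
Proof.
move=> nz_hi; have ex : exists i, h i != 0 by exists i.
exists (ex_minn ex); case: ex_minnP => o nz_ho o_min; last exact: o_min.
by split=> // l lt_lo; apply/eqP/negPn/negP => /o_min; rewrite leqNgt lt_lo.
Qed.

Lemma ps_ord_psmul (a b : ps) o o' :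
  ps_ord a o -> ps_ord b o' -> ps_ord (psmul a b) (o + o').
Proof.
move=> [nz_a lt_a] [nz_b lt_b]; split=> [|i lt_i].
  have lt_o : (o < (o + o').+1)%N by rewrite ltnS leq_addr.
  rewrite /psmul (bigD1 (Ordinal lt_o)) //= addKn big1 ?addr0 ?mulf_neq0 // => l.
  rewrite -val_eqE neq_ltn => /orP[/lt_a ->|]; first by rewrite mul0r.
  by move=> /= lt_ol; rewrite lt_b ?mulr0 //; have := ltn_ord l; lia.
rewrite /psmul big1 // => l _; have [/lt_a ->|le_ol] := ltnP l o; first by rewrite mul0r.
by rewrite lt_b ?mulr0 //; have := ltn_ord l; lia.
Qed.

(* Read off the expansion, the flag valuation is the lexicographic order in [(j, i)]. *)
Definition flag_order (xi : ps) (F : {mpoly CC[3]}) (m o : nat) : Prop :=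
  (forall i j, (j < m)%N -> expand xi F i j = 0) /\ ps_ord (expand xi F ^~ m) o.

Lemma ps_ord_flag_order xi F o :
  ps_ord (expand xi F ^~ 0%N) o -> flag_order xi F 0 o.
Proof. by split. Qed.

Lemma flag_orderM xi F H m o m' o' : flag_order xi F m o -> flag_order xi H m' o' ->
  flag_order xi (F * H) (m + m') (o + o').
Proof.
move=> [F0 ordF] [H0 ordH]; split=> [i j lt_j|].
  rewrite expandM big1 // => b _; rewrite big1 // => a _.
  have [lt_bm|le_mb] := ltnP b m; first by rewrite F0 ?mul0r.
  by rewrite H0 ?mulr0 //; have := ltn_ord b; lia.
have rowE i : expand xi (F * H) i (m + m') =
    psmul (expand xi F ^~ m) (fun i => expand xi H i m') i.
  have lt_m : (m < (m + m').+1)%N by rewrite ltnS leq_addr.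
  rewrite expandM (bigD1 (Ordinal lt_m)) //= addKn [X in _ + X]big1 ?addr0 // => b.
  rewrite -val_eqE neq_ltn /= => ne_bm; rewrite big1 // => a _.
  case/orP: ne_bm => [/F0 ->|lt_mb]; first by rewrite mul0r.
  by rewrite H0 ?mulr0 //; have := ltn_ord b; lia.
have [nz lt] := ps_ord_psmul ordF ordH.
by split=> [|i /lt]; rewrite rowE.
Qed.

Lemma flag_order1 xi : flag_order xi 1 0 0.
Proof.
have expand1 i : expand xi 1 i 0 = (i == 0)%:R.
  by have := expand_XZ xi 0 0 i 0; rewrite mulr1 andbT.
by apply: ps_ord_flag_order; split=> //; rewrite expand1 oner_neq0.
Qed.

Lemma flag_orderX xi F m o n : flag_order xi F m o ->
  flag_order xi (F ^+ n) (n * m) (n * o).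
Proof.
move=> ordF; elim: n => [|n IHn]; first exact: flag_order1.
by rewrite exprS !mulSn; exact: flag_orderM.
Qed.

Lemma expand_row0_mull xi A H n : (forall i, (i < n)%N -> expand xi H i 0 = 0) ->
  forall i, (i < n)%N -> expand xi (A * H) i 0 = 0.
Proof.
move=> H0 i lt_in; rewrite expandM big_ord1 big1 // => a _.
by rewrite H0 ?mulr0 // (leq_ltn_trans _ lt_in) // leq_subr.
Qed.

Definition vanishes_on (xi : ps) (F : {mpoly CC[3]}) : Prop :=
  forall i, expand xi F i 0 = 0.

Lemma vanishes_on_mull xi A H : vanishes_on xi H -> vanishes_on xi (A * H).
Proof. by move=> H0 i; apply: (@expand_row0_mull _ _ _ i.+1) => // l _; exact: H0. Qed.

Lemma vanishes_on_add xi F H : vanishes_on xi F -> vanishes_on xi H ->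
  vanishes_on xi (F + H).
Proof. by move=> F0 H0 i; rewrite expandD F0 H0 addr0. Qed.

Lemma nvanishes_on_ord xi F : ~ vanishes_on xi F ->
  exists o, ps_ord (expand xi F ^~ 0%N) o.
Proof.
move=> /not_all_ex_not[i /eqP nz_Fi].
by have [o ordF _] := ps_ord_exists (h := fun i => expand xi F i 0) nz_Fi; exists o.
Qed.

Lemma vanishes_on_prime xi A B : vanishes_on xi (A * B) ->
  vanishes_on xi A \/ vanishes_on xi B.
Proof.
move=> AB0; have [|/nvanishes_on_ord[o ordA]] := classic (vanishes_on xi A); first by left.
have [|/nvanishes_on_ord[o' ordB]] := classic (vanishes_on xi B); first by right.
have [_ [/eqP []]] := flag_orderM (ps_ord_flag_order ordA) (ps_ord_flag_order ordB).
exact: AB0.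
Qed.

Section CurveIdeal.
Variables (d : nat) (G : {mpoly CC[3]}) (xi : ps).
Hypotheses (homG : G \is d.-homog) (irrG : mirreducible G) (GO : G.@[ptO] = 0)
  (Gxi : vanishes_on xi G).

Lemma vanishes_on_mdvd n H : H \is n.-homog -> vanishes_on xi H -> mdvd G H.
Proof.
move=> homH H0; pose I p := vanishes_on xi (mpolyXY p).
have I_dehom F : vanishes_on xi F -> I (dehom F).
  by move=> F0 i; rewrite -(F0 i); apply: eq_expand_dehom; rewrite mpolyXYK.
have I_comb p q f g : I f -> I g -> I (p * f + q * g).
  move=> If Ig; rewrite /I rmorphD !rmorphM.
  exact: vanishes_on_add (vanishes_on_mull _ If) (vanishes_on_mull _ Ig).
have I_prime p q : I (p * q) -> I p \/ I q.
  by rewrite /I rmorphM; exact: vanishes_on_prime.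
have I_polyC (c : {poly CC}) : I c%:P -> c = 0.
  by move=> Ic; apply/polyP => i; rewrite coef0; have := Ic i; rewrite expand_mpolyXY_polyC.
have nz_G : dehom G != 0 by rewrite (dehom_homog_eq0 homG) mirreducible_neq0.
have [q HE] := irreducible_generates_prime_ideal I_comb I_prime I_polyC
  (I_dehom _ Gxi) nz_G (dehom_irreducible homG irrG) (I_dehom _ H0).
exact (dvd_of_dehom homG irrG GO homH HE).
Qed.

Lemma koszul_syzygy k A B H : B \is k.-homog -> ~ vanishes_on xi H ->
  A * G + B * H = 0 ->
  exists Q, [/\ Q \is (k - d).-homog, A = - (Q * H) & B = Q * G].
Proof.
have nz_G := mirreducible_neq0 irrG.
move=> homB nH0 /eqP; rewrite addrC addr_eq0 => /eqP BH.
have [B0|//] : vanishes_on xi B \/ vanishes_on xi H.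
  by apply: vanishes_on_prime; rewrite BH -mulNr; exact: vanishes_on_mull.
have [Q BE] := vanishes_on_mdvd homB B0; exists Q; split.
- have [Q0|nz_Q] := eqVneq Q 0; first by rewrite Q0 rpred0.
  have nz_B : B != 0 by rewrite BE mulf_neq0.
  by have [] := dhomog_cofactor nz_B homB homG BE.
- by apply: (mulIf nz_G); rewrite -[LHS]opprK -BH BE; ring.
- by rewrite mulrC.
Qed.

End CurveIdeal.

(** * Bezout at a point of the branch *)

Local Notation form k := (dhomog 3 CC k).

Lemma dim_form k : (dim (form k) * 2 = k.+2 * k.+1)%N.
Proof.
have -> : dim (form k) = 'C(k + 2, k) by [].
by rewrite -bin_sub ?leq_addr // addKn addn2 bin_ffact !ffactnS ffactn0 muln1.
Qed.

Definition form_proj (k : nat) (F : {mpoly CC[3]}) : form k := DHomog (pihomogP mdeg k F).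

Lemma form_proj_is_linear k : linear (form_proj k).
Proof. by move=> c F P; apply: val_inj; rewrite linearP /= linearP. Qed.

HB.instance Definition _ k :=
  GRing.isLinear.Build CC {mpoly CC[3]} (form k) _ _ (form_proj_is_linear k).

Lemma form_projE k F : F \is k.-homog -> val (form_proj k F) = F.
Proof. exact: pihomog_dE. Qed.

Lemma form_proj_eq0 k F : F \is k.-homog -> form_proj k F = 0 -> F = 0.
Proof. by move=> /form_projE {2}<- ->. Qed.

Definition formXZ (k N : nat) (c : 'rV[CC]_N) : {mpoly CC[3]} :=
  \sum_(i < N) c 0 i *: ('X_iX ^+ i * 'X_iZ ^+ (k - i)).

Lemma formXZ_is_linear k N : linear (@formXZ k N).
Proof.
move=> a c c'; rewrite /formXZ scaler_sumr -big_split; apply: eq_bigr => i _.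
by rewrite !mxE scalerDl scalerA.
Qed.

HB.instance Definition _ k N :=
  GRing.isLinear.Build CC 'rV[CC]_N {mpoly CC[3]} _ _ (@formXZ_is_linear k N).

Lemma formXZ_homog k N (c : 'rV[CC]_N) : (N <= k.+1)%N -> formXZ k c \is k.-homog.
Proof.
move=> le_N; apply: rpred_sum => i _; apply: rpredZ.
apply: dhomogM_deg (dhomog_varXn _ _ _) (dhomog_varXn _ _ _).
by rewrite subnKC // -ltnS (leq_trans (ltn_ord i)).
Qed.

Lemma expand_formXZ xi k N (c : 'rV[CC]_N) (i : 'I_N) :
  expand xi (formXZ k c) i 0 = c 0 i.
Proof.
have -> : expand xi (formXZ k c) i 0 =
    \sum_(l < N) c 0 l * expand xi ('X_iX ^+ l * 'X_iZ ^+ (k - l)) i 0.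
  apply: (big_ind2 (fun F a => expand xi F i 0 = a)) => [|F a H b <- <-|l _].
  - exact: expand0.
  - exact: expandD.
  - exact: expandZ.
rewrite (bigD1 i) //= expand_XZ !eqxx mulr1 big1 ?addr0 // => l.
by rewrite -val_eqE expand_XZ /= eq_sym => /negPf ->; rewrite mulr0.
Qed.

Section Bezout.
Variables (d : nat) (G : {mpoly CC[3]}) (xi : ps).
Hypotheses (homG : G \is d.-homog) (irrG : mirreducible G) (GO : G.@[ptO] = 0)
  (Gxi : vanishes_on xi G).
Variables (e o : nat) (H : {mpoly CC[3]}).
Hypotheses (homH : H \is e.-homog) (ordH : ps_ord (expand xi H ^~ 0%N) o).

Let p := (d * e)%N.
Let pencil : vectType CC := (form (p + e) * form (p + d) * 'rV[CC]_p.+1)%type.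

Let combination (u : pencil) : {mpoly CC[3]} :=
  val u.1.1 * G + val u.1.2 * H + formXZ (p + d + e) u.2.

Let combination_is_linear : linear combination.
Proof.
move=> c [[A B] f] [[A' B'] f']; rewrite /combination /= !linearP /= !mulrDl -!scalerAl.
by rewrite !scalerDr [X in X + _ = _]addrACA [LHS]addrACA.
Qed.

HB.instance Definition _ :=
  GRing.isLinear.Build CC pencil {mpoly CC[3]} _ _ combination_is_linear.

Let syzygy (t : form p) : pencil :=
  (form_proj _ (- (val t * H)), form_proj _ (val t * G), 0).

Let syzygy_is_linear : linear syzygy.
Proof.
move=> c u v; rewrite /syzygy; congr (_, _, _); last by rewrite /= scaler0 addr0.
- by rewrite linearP /= mulrDl -scalerAl opprD -scalerN; exact: linearP.
- by rewrite linearP /= mulrDl -scalerAl; exact: linearP.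
Qed.

HB.instance Definition _ := GRing.isLinear.Build CC (form p) pencil _ _ syzygy_is_linear.

Let exact_syzygy (u : pencil) : (p < o)%N ->
  form_proj (p + d + e) (combination u) = 0 -> exists t, u = syzygy t.
Proof.
case: u => [[A B] c] lt_po comb0; have [nz_o H0] := ordH.
have nH0 : ~ vanishes_on xi H by move=> /(_ o) /eqP; rewrite (negPf nz_o).
have homAG : val A * G \is (p + d + e).-homog.
  by apply: dhomogM_deg (valP A) homG; rewrite addnAC.
have homBH : val B * H \is (p + d + e).-homog by apply: dhomogM (valP B) homH.
have {comb0} : combination (A, B, c) = 0.
  apply: form_proj_eq0 comb0; rewrite !rpredD //=.
  by apply: formXZ_homog; rewrite ltnS -addnA leq_addr.
rewrite /combination /= => comb_eq0.
have c0 : c = 0.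
  apply/rowP => i; rewrite mxE -(expand_formXZ xi (p + d + e)).
  have := congr1 (fun F => expand xi F i 0) comb_eq0.
  rewrite !expandD expand0 (vanishes_on_mull _ Gxi) add0r.
  by rewrite (expand_row0_mull _ H0) ?add0r // (leq_trans (ltn_ord i)).
move: comb_eq0; rewrite c0 linear0 addr0.
case/(koszul_syzygy homG irrG GO Gxi (valP B) nH0); rewrite addnK => Q [homQ AE BE].
exists (form_proj _ Q); congr (_, _, _); apply: val_inj.
  by rewrite [RHS]form_projE form_projE // -AE; exact: valP.
by rewrite [RHS]form_projE form_projE // -BE; exact: valP.
Qed.

Lemma bezout_order_le : (o <= d * e)%N.
Proof.
rewrite leqNgt; apply/negP => lt_po.
have := dim_leq_exact (L := form_proj _ \o combination)
  (fun u => @exact_syzygy u lt_po).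
have -> : dim pencil = (dim (form (p + e)) + dim (form (p + d)) + 1 * p.+1)%N by [].
move: (dim_form p) (dim_form (p + e)) (dim_form (p + d)) (dim_form (p + d + e)).
have : p = (d * e)%N by [].
move: (dim _) (dim _) (dim _) (dim _) => *; nia.
Qed.

End Bezout.

(** * Forms whose expansion starts near a corner *)

Lemma sum_sub_maxn r t :
  (\sum_(j < (r + t).+1) (r + t - maxn j r) = r * t + 'C(t.+1, 2))%N.
Proof.
rewrite -addnS big_split_ord /=; congr (_ + _)%N.
  under eq_bigr => j _ do rewrite (maxn_idPr (ltnW (ltn_ord j))) addKn.
  by rewrite sum_nat_const card_ord.
under eq_bigr => j _ do rewrite (maxn_idPl (leq_addr j r)) subnDl.
rewrite -bin2_sum big_mkord (reindex_inj rev_ord_inj) /=.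
by apply: eq_bigr => j _; rewrite subSS subKn // -ltnS.
Qed.

Section CornerForm.
Variables (d r : nat).
Hypotheses (d_gt0 : (0 < d)%N) (r_gt0 : (0 < r)%N).

(* This choice of [n] makes the number of conditions [d ^ 2 * n ^ 2 / 2 + n + 1]. *)
Let n := (r + r ^ 2)%N.

Definition off_corner : seq (nat * nat) :=
  [seq (i, j) | j <- iota 0 n.+1, i <- iota 0 (d ^ 2 * (n - maxn j r)).+1].

Lemma size_off_corner : (size off_corner < dim (form (d * n)))%N.
Proof.
have -> : size off_corner = (d ^ 2 * (r * r ^ 2 + 'C((r ^ 2).+1, 2)) + n.+1)%N.
  rewrite size_allpairs_dep sumnE big_map -[iota _ _]/(index_iota 0 n.+1) big_mkord.
  under eq_bigr => j _ do rewrite size_iota -addn1.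
  by rewrite big_split /= -big_distrr sum_sub_maxn sum_nat_const card_ord muln1.
have := dim_form (d * n); have : ('C((r ^ 2).+1, 2) * 2 = (r ^ 2).+1 * r ^ 2)%N.
  by rewrite bin2 muln2 halfK /= oddM /= andNb subn0.
move: ('C(_, _)) (dim _) d_gt0 r_gt0; rewrite /n; nia.
Qed.

Lemma corner_form_exists (xi : ps) : exists2 F : {mpoly CC[3]},
  F \is (d * n).-homog /\ F != 0 &
  forall i j, (i + d ^ 2 * j <= d * (d * n))%N -> expand xi F i j != 0 ->
    (j < r)%N /\ (d ^ 2 * r ^ 2 < i)%N.
Proof.
have [F nz_F F0] := common_zero (V := form (d * n))
  (f := fun (t : nat * nat) F => expand xi (val F) t.1 t.2)
  (fun t c F H => expand_linear xi c (val F) (val H) t.1 t.2) size_off_corner.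
exists (val F) => [|i j le_ij nz_ij]; first by split=> //; exact: valP.
have le_jn : (j <= n)%N.
  rewrite -(leq_pmul2l (_ : 0 < d ^ 2)%N) ?expn_gt0 ?d_gt0 //.
  by apply: leq_trans (leq_addl i _) _; rewrite (leq_trans le_ij) // mulnA.
have lt_i : (d ^ 2 * (n - maxn j r) < i)%N.
  rewrite ltnNge; apply: contraNN nz_ij => le_i; apply/eqP/(F0 (i, j))/allpairsPdep.
  by exists j, i; rewrite !mem_iota /= !add0n !ltnS.
have lt_jr : (j < r)%N.
  rewrite ltnNge; apply/negP => le_rj; move: lt_i; rewrite (maxn_idPl le_rj).
  by move: le_ij le_jn; rewrite mulnBr; nia.
by split=> //; move: lt_i; rewrite (maxn_idPr (ltnW lt_jr)) addKn.
Qed.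

End CornerForm.

(** * Valuations of forms *)

Lemma rat_slope_nat (s : rat) : 0 <= s -> exists a b, (0 < b)%N /\
  forall i j : nat, i%:Q + s * j%:Q = (b * i + a * j)%:R / b%:R.
Proof.
move=> s_ge0; exists `|numq s|%N, `|denq s|%N; split; first by rewrite absz_gt0 denq_neq0.
move=> i j; have nz_den : (`|denq s|%N)%:R != 0 :> rat.
  by rewrite pnatr_eq0 absz_eq0 denq_neq0.
have sE : s = `|numq s|%N%:R / `|denq s|%N%:R.
  by rewrite !pmulrn !gez0_abs ?divq_num_den ?numq_ge0.
by rewrite {1}sE natrD !natrM -!pmulrn; field.
Qed.

Lemma vplus_at_exists xi (s : rat) F i0 j0 : 0 <= s -> expand xi F i0 j0 != 0 ->
  exists i j, vplus_at xi s F i j.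
Proof.
move=> /rat_slope_nat[a [b [b_gt0 valE]]] nz_F.
pose val (x : nat * nat) := (b * x.1 + a * x.2)%N.
have [x nz_x x_min] :=
  @exists_minimizer _ (fun x => expand xi F x.1 x.2 != 0) val (i0, j0) nz_F.
have [[i j] [/= nz_ij valxE] j_min] := @exists_minimizer _
  (fun y => expand xi F y.1 y.2 != 0 /\ val y = val x) snd x (conj nz_x erefl).
exists i, j; split=> // i' j' nz_ij'; rewrite !valE -/(val (i, j)) -/(val (i', j')).
have bV_gt0 : 0 < b%:R^-1 :> rat by rewrite invr_gt0 ltr0n.
rewrite ler_pM2r // ler_nat valxE; split; first exact: x_min (i', j') nz_ij'.
move=> /(mulIf (lt0r_neq0 bV_gt0))/eqP; rewrite eqr_nat => /eqP eq_val.
exact: j_min (i', j') (conj nz_ij' eq_val).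
Qed.

Section Curve.
Variables (d : nat) (G : {mpoly CC[3]}) (xi : ps).
Hypotheses (homG : G \is d.-homog) (irrG : mirreducible G) (GO : G.@[ptO] = 0)
  (Gxi : vanishes_on xi G).

Lemma nu_at_le k F m o : F \is k.-homog -> F != 0 -> nu_at G xi F m o ->
  (o + d ^ 2 * m <= d * k)%N.
Proof.
move=> homF nz_F [H [FE [_ ordH]]].
have [le_mk homH] := dhomog_cofactor nz_F homF (dhomogMn m homG) FE.
rewrite -[in leqRHS](subnK le_mk) mulnDr mulnA leq_add2r.
exact (bezout_order_le homG irrG GO Gxi homH ordH).
Qed.

Hypothesis d_gt0 : (0 < d)%N.

Lemma curve_factorization k F : F \is k.-homog -> F != 0 ->
  exists m H, F = G ^+ m * H /\ ~ mdvd G H.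
Proof.
have [b] := ubnP k; elim: b k F => // b IHb k F lt_kb homF nz_F.
have [[Q FE]|] := classic (mdvd G F); last by exists 0%N, F; rewrite mul1r.
have [le_dk homQ] := dhomog_cofactor nz_F homF homG FE.
have nz_Q : Q != 0 by apply: contraNneq nz_F => Q0; rewrite FE Q0 mulr0.
have lt_kdb : (k - d < b)%N by lia.
have [m [H [QE ndvd_H]]] := IHb _ Q lt_kdb homQ nz_Q.
by exists m.+1, H; split=> //; rewrite FE QE exprS mulrA.
Qed.

Lemma nu_at_exists k F : F \is k.-homog -> F != 0 -> exists m o, nu_at G xi F m o.
Proof.
move=> homF nz_F; have [m [H [FE ndvd_H]]] := curve_factorization homF nz_F.
have [_ homH] := dhomog_cofactor nz_F homF (dhomogMn m homG) FE.
have [o ordH] : exists o, ps_ord (expand xi H ^~ 0%N) o.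
  by apply: nvanishes_on_ord => /(vanishes_on_mdvd homG irrG GO Gxi homH).
by exists m, o, H.
Qed.

Hypotheses (dGO : (mderiv iY G).@[ptO] != 0) (xi0 : xi 0%N = 0).

Lemma flag_order_curve : flag_order xi G 1 0.
Proof.
split=> [i [_|//]|]; first exact: Gxi.
by split=> //; rewrite expand_mderivY.
Qed.

Lemma nu_at_flag_order F m o : nu_at G xi F m o -> flag_order xi F m o.
Proof.
move=> [H [-> [_ ordH]]].
have := flag_orderM (flag_orderX m flag_order_curve) (ps_ord_flag_order ordH).
by rewrite muln1 muln0 addn0.
Qed.

Lemma vplus_at_le (s : rat) k F i j : ((d ^ 2)%N)%:Q <= s -> F \is k.-homog ->
  F != 0 -> vplus_at xi s F i j -> (i + d ^ 2 * j <= d * k)%N.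
Proof.
move=> s_ge homF nz_F [nz_ij min_ij]; have [m [o nuF]] := nu_at_exists homF nz_F.
have [F0 [nz_o _]] := nu_at_flag_order nuF.
have le_mj : (m <= j)%N.
  by rewrite leqNgt; apply/negP => lt_jm; rewrite F0 ?eqxx in nz_ij.
have [le_val _] := min_ij _ _ nz_o.
apply: leq_trans (nu_at_le homF nz_F nuF); rewrite -(ler_nat rat) !natrD !natrM.
move: s_ge le_val; rewrite -!pmulrn => s_ge le_val.
have : 0 <= (s - (d ^ 2)%:R) * (j%:R - m%:R) by rewrite mulr_ge0 ?subr_ge0 // ler_nat.
lra.
Qed.

End Curve.

(** * Convex sets in the plane *)

Lemma sub_closure2 (S : set2) p : S p -> closure2 S p.
Proof. by move=> Sp e e_gt0; exists p; rewrite !subrr normr0. Qed.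

Lemma closure2_mono (S T : set2) p :
  (forall q, S q -> T q) -> closure2 S p -> closure2 T p.
Proof. by move=> ST Sp e /Sp[q [/ST Tq near_q]]; exists q. Qed.

Lemma conv_hull_mono (S T : set2) p :
  (forall q, S q -> T q) -> conv_hull S p -> conv_hull T p.
Proof.
move=> ST [n [w [q [w_ge0 [sum_w [Sq pE]]]]]].
by exists n, w, q; do !split=> //; move=> i; exact: ST.
Qed.

Lemma eq_closure_conv_hull (S T : set2) :
  seteq2 S T -> seteq2 (closure2 (conv_hull S)) (closure2 (conv_hull T)).
Proof.
by move=> ST p; split; apply: closure2_mono => q; apply: conv_hull_mono => r /ST.
Qed.

Lemma convex_combination_close n (w u v : 'I_n -> RR) (e : RR) :
    (forall i, 0 <= w i) -> \sum_(i < n) w i = 1 -> (forall i, `|u i - v i| < e) ->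
  `|\sum_(i < n) w i * u i - \sum_(i < n) w i * v i| < e.
Proof.
move=> w_ge0 sum_w close_uv; rewrite -sumrB.
have [i0 w_i0] : exists i, 0 < w i.
  apply: NNPP => w_le0; have /eqP := sum_w.
  rewrite big1 ?(eq_sym 0) ?oner_eq0 // => i _; apply/eqP.
  by rewrite eq_le w_ge0 andbT leNgt; apply/negP => w_i; apply: w_le0; exists i.
rewrite -[ltRHS]mul1r -sum_w mulr_suml; apply: le_lt_trans (ler_norm_sum _ _ _) _.
rewrite (bigD1 i0) //= [ltRHS](bigD1 i0) //= ltr_leD //.
  by rewrite -mulrBr normrM ger0_norm // ltr_pM2l.
by apply: ler_sum => i _; rewrite -mulrBr normrM ger0_norm // ler_wpM2l // ltW.
Qed.

Lemma conv_hull_closure (S : set2) p :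
  conv_hull (closure2 S) p -> closure2 (conv_hull S) p.
Proof.
move=> [n [w [q [w_ge0 [sum_w [Sq ->]]]]]] e e_gt0.
have /fin_all_exists[q' q'P] i := Sq i e e_gt0.
exists (\sum_(i < n) w i * (q' i).1, \sum_(i < n) w i * (q' i).2); split.
  by exists n, w, q'; do !split=> //; move=> i; have [] := q'P i.
by split; apply: convex_combination_close => // i; have [_ []] := q'P i.
Qed.

Definition halfplane (a b c : RR) : set2 := fun p => 0 <= a + b * p.1 + c * p.2.

Lemma conv_hull_halfplane (a b c : RR) (S : set2) p :
  (forall q, S q -> halfplane a b c q) -> conv_hull S p -> halfplane a b c p.
Proof.
move=> S_ge0 [n [w [q [w_ge0 [sum_w [Sq ->]]]]]]; rewrite /halfplane /=.
have -> : a + b * (\sum_(i < n) w i * (q i).1) + c * (\sum_(i < n) w i * (q i).2) =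
    \sum_(i < n) w i * (a + b * (q i).1 + c * (q i).2).
  rewrite -[X in X + _ + _]mulr1 -sum_w !mulr_sumr -!big_split /=.
  by apply: eq_bigr => i _; ring.
by apply: sumr_ge0 => i _; rewrite mulr_ge0 //; exact: S_ge0.
Qed.

Lemma linear_form_close (b c e : RR) (p q : RR * RR) :
    `|p.1 - q.1| < e -> `|p.2 - q.2| < e ->
  `|b * p.1 + c * p.2 - (b * q.1 + c * q.2)| <= (`|b| + `|c|) * e.
Proof.
move=> /ltW le1 /ltW le2.
rewrite (_ : _ - _ = b * (p.1 - q.1) + c * (p.2 - q.2)); last by ring.
by rewrite (le_trans (ler_normD _ _)) // !normrM mulrDl lerD // ler_wpM2l.
Qed.

Lemma closure2_halfplane (a b c : RR) (S : set2) p :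
  (forall q, S q -> halfplane a b c q) -> closure2 S p -> halfplane a b c p.
Proof.
move=> S_ge0 Sp; rewrite /halfplane leNgt; apply/negP => lt0.
have D_gt0 : 0 < `|b| + `|c| + 1 by rewrite ltr_wpDl ?addr_ge0.
pose e := - (a + b * p.1 + c * p.2) / (`|b| + `|c| + 1).
have e_gt0 : 0 < e by rewrite divr_gt0 // oppr_gt0.
have [q [/S_ge0 q_ge0 [close1 close2]]] := Sp e e_gt0.
have := linear_form_close b c close1 close2; rewrite ler_norml => /andP[le_e _].
have : (`|b| + `|c| + 1) * e = - (a + b * p.1 + c * p.2).
  by rewrite mulrC divfK // gt_eqF.
by move: q_ge0 le_e; rewrite /halfplane => *; lra.
Qed.

Lemma triangleP (a b c : RR) p : 0 < a -> 0 < c -> triangle a b c p <->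
  [/\ halfplane 0 0 1 p, halfplane 0 c (- b) p & halfplane (a * c) (- c) (b - a) p].
Proof.
move=> a_gt0 c_gt0; have ac_gt0 : 0 < a * c by rewrite mulr_gt0.
split=> [Tp|].
  by split; apply: conv_hull_halfplane Tp => q [->|[->|->]]; rewrite /halfplane /=; nra.
case: p => t u [] /=; rewrite /halfplane /= => u_ge0 left_ge0 right_ge0.
have [nz_a nz_c] : a != 0 /\ c != 0 by rewrite !gt_eqF.
pose wc := u / c; pose wa := (c * t - b * u) / (a * c).
exists 3%N, (fun i => if i == iX then 1 - wa - wc else if i == iY then wa else wc),
  (fun i => if i == iX then (0, 0) else if i == iY then (a, 0) else (b, c)).
split=> [i|].
  case: ifP => _; last case: ifP => _.
  - rewrite (_ : 1 - wa - wc = (a * c + - c * t + (b - a) * u) / (a * c)).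
      by rewrite divr_ge0 // ltW.
    by rewrite /wa /wc; field; rewrite nz_a nz_c.
  - by rewrite divr_ge0 ?(ltW ac_gt0) //; lra.
  - by rewrite divr_ge0 ?(ltW c_gt0) //; lra.
rewrite !big_ord3 /=; split; first by ring.
split=> [i|]; first by case: ifP => _; [left | case: ifP => _; right; [left | right]].
by rewrite /wa /wc; congr (_, _); field; rewrite nz_a nz_c.
Qed.

Lemma closure_conv_hull_triangle (a b c : RR) (S : set2) : 0 < a -> 0 < c ->
    (forall p, S p -> triangle a b c p) ->
    closure2 S (0, 0) -> closure2 S (a, 0) -> closure2 S (b, c) ->
  seteq2 (closure2 (conv_hull S)) (triangle a b c).
Proof.
move=> a_gt0 c_gt0 ST S0 Sa Sbc p; split=> [Sp|Tp]; last first.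
  by apply: conv_hull_closure; apply: conv_hull_mono Tp => q [->|[->|->]].
have ST' q : S q -> _ := fun Sq => (triangleP b q a_gt0 c_gt0).1 (ST q Sq).
apply/triangleP => //.
by split; apply: closure2_halfplane Sp => q; apply: conv_hull_halfplane => r /ST'[].
Qed.

Section LinearImage.
Variables x y z w : RR.

Lemma eq_matimg (S T : set2) :
  seteq2 S T -> seteq2 (matimg x y z w S) (matimg x y z w T).
Proof. by move=> ST p; split=> -[q [/ST Tq ->]]; exists q. Qed.

Lemma matimg_conv_hull (S : set2) :
  seteq2 (matimg x y z w (conv_hull S)) (conv_hull (matimg x y z w S)).
Proof.
have sumE n (a u v : 'I_n -> RR) b c : b * (\sum_i a i * u i) + c * (\sum_i a i * v i) =
    \sum_i a i * (b * u i + c * v i).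
  by rewrite !mulr_sumr -big_split; apply: eq_bigr => i _ /=; ring.
move=> p; split=> [[_ [[n [a [q [a_ge0 [sum_a [Sq ->]]]]]] ->]]|].
  exists n, a, (fun i => (x * (q i).1 + y * (q i).2, z * (q i).1 + w * (q i).2)).
  by rewrite /= !sumE; do !split=> //; move=> i; exists (q i).
move=> [n [a [q [a_ge0 [sum_a [Sq ->]]]]]].
have /fin_all_exists[q' q'P] := Sq.
exists (\sum_(i < n) a i * (q' i).1, \sum_(i < n) a i * (q' i).2); split.
  by exists n, a, q'; do !split=> //; move=> i; have [] := q'P i.
by rewrite /= !sumE; congr (_, _); apply: eq_bigr => i _; have [_ ->] := q'P i.
Qed.

Lemma matimg_closure (S : set2) p :
  matimg x y z w (closure2 S) p -> closure2 (matimg x y z w S) p.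
Proof.
move=> [q [Sq ->]] e e_gt0; pose M := `|x| + `|y| + `|z| + `|w| + 1.
have M_gt0 : 0 < M by rewrite ltr_wpDl // !addr_ge0.
have [q' [Sq' [close1 close2]]] := Sq (e / M) (divr_gt0 e_gt0 M_gt0).
exists (x * q'.1 + y * q'.2, z * q'.1 + w * q'.2); split; first by exists q'.
have eE : e = M * (e / M) by rewrite mulrC divfK // gt_eqF.
have eM_gt0 : 0 < e / M by rewrite divr_gt0.
have [x0 y0 z0 w0] := And4 (normr_ge0 x) (normr_ge0 y) (normr_ge0 z) (normr_ge0 w).
split; rewrite /= [ltRHS]eE; apply: le_lt_trans (linear_form_close _ _ close1 close2) _;
  by rewrite ltr_pM2r // /M; lra.
Qed.

End LinearImage.

Lemma closure_matimg x y z w (S : set2) p : x * w - y * z != 0 ->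
  closure2 (matimg x y z w S) p -> matimg x y z w (closure2 S) p.
Proof.
set D := x * w - y * z => nz_D Sp.
have invS q : matimg (w / D) (- y / D) (- z / D) (x / D) (matimg x y z w S) q -> S q.
  move=> [_ [[r [Sr ->]] ->]] /=.
  rewrite (_ : (_, _) = r) //; case: r {Sr} => t u /=.
  by rewrite /D; congr (_, _); field.
exists (w / D * p.1 + - y / D * p.2, - z / D * p.1 + x / D * p.2); split; last first.
  by case: p {Sp} => t u /=; rewrite /D; congr (_, _); field.
by apply: closure2_mono invS _; apply: matimg_closure; exists p.
Qed.

Lemma closure_conv_hull_matimg x y z w (S : set2) : x * w - y * z != 0 ->
  seteq2 (closure2 (conv_hull (matimg x y z w S)))
         (matimg x y z w (closure2 (conv_hull S))).
Proof.
move=> nz_D p; split=> [Sp|/matimg_closure].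
  by apply: closure_matimg nz_D _; apply: closure2_mono Sp => q /matimg_conv_hull.
by apply: closure2_mono => q /matimg_conv_hull.
Qed.

Lemma matimg_triangle x y z w a b c (u v : RR * RR) :
    (x * a, z * a) = u -> (x * b + y * c, z * b + w * c) = v ->
  seteq2 (matimg x y z w (triangle a b c))
    (conv_hull (fun p => p = (0, 0) \/ p = u \/ p = v)).
Proof.
move=> <- <- p; split.
  move=> /matimg_conv_hull; apply: conv_hull_mono => _ [_ [[->|[->|->]] ->]] /=.
  - by left; rewrite !mulr0 addr0.
  - by right; left; rewrite !mulr0 !addr0.
  - by right; right.
move=> Tp; apply/matimg_conv_hull; apply: conv_hull_mono Tp => q [->|[->|->]].
- by exists (0, 0); rewrite /= !mulr0 addr0; split; [left|].
- by exists (a, 0); rewrite /= !mulr0 !addr0; split; [right; left|].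
- by exists (b, c); split; [right; right|].
Qed.

Lemma conv_hull_swap (u v : RR * RR) :
  seteq2 (conv_hull (fun p => p = (0, 0) \/ p = u \/ p = v))
         (conv_hull (fun p => p = (0, 0) \/ p = v \/ p = u)).
Proof. by move=> p; split; apply: conv_hull_mono => q; tauto. Qed.

(** * The two bodies *)

Lemma archimedean_quotient (x e : RR) : 0 < e ->
  exists2 r : nat, (0 < r)%N & x / r.+1%:R < e.
Proof.
move=> e_gt0; pose n := Num.bound (`|x / e| : Rdefinitions.R).
have lt_n : x / e < n%:R.
  exact: le_lt_trans (ler_norm _) (archi_boundP (normr_ge0 (x / e : Rdefinitions.R))).
exists n.+1 => //; rewrite ltr_pdivrMr ?ltr0n // mulrC -ltr_pdivrMr //.
by rewrite (lt_le_trans lt_n) // ler_nat -addn2 leq_addr.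
Qed.

(* [sel F i j] says that the valuation of [F] is read off the coefficient [a_ij]. *)
Definition index_body (sel : {mpoly CC[3]} -> nat -> nat -> Prop) : set2 :=
  closure2 (conv_hull (fun p =>
    exists (k : nat) (F : {mpoly CC[3]}) (i j : nat),
      (0 < k)%N /\ homog3 k F /\ F != 0 /\ sel F i j /\
      p = (i%:R / k%:R, j%:R / k%:R))).

Section IndexBody.
Variables (d : nat) (G : {mpoly CC[3]}) (xi : ps).
Hypotheses (d_gt0 : (0 < d)%N) (homG : G \is d.-homog) (nz_G : G != 0)
  (Gxi : vanishes_on xi G).

Variable sel : {mpoly CC[3]} -> nat -> nat -> Prop.
Hypotheses (sel_exists : forall k F, F \is k.-homog -> F != 0 -> exists i j, sel F i j)
  (sel_expand : forall F i j, sel F i j -> expand xi F i j != 0)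
  (sel_le : forall k F i j, F \is k.-homog -> F != 0 -> sel F i j ->
     (i + d ^ 2 * j <= d * k)%N).

Let d_gt0R : 0 < d%:R :> RR. Proof. by rewrite ltr0n. Qed.

Lemma scaled_index_in_triangle k i j : (0 < k)%N -> (i + d ^ 2 * j <= d * k)%N ->
  triangle d%:R 0 (1 / d%:R) (i%:R / k%:R, j%:R / k%:R).
Proof.
move=> k_gt0; rewrite -(ler_nat RR) natrD natrM natrX natrM => le_ij.
have k_gt0R : 0 < k%:R :> RR by rewrite ltr0n.
apply/(triangleP _ _ d_gt0R (divr_gt0 ltr01 d_gt0R)); rewrite /halfplane /=.
split; first by rewrite add0r mul0r add0r mul1r divr_ge0.
  by rewrite add0r oppr0 mul0r addr0 mulr_ge0 ?divr_ge0.
rewrite (_ : _ + _ + _ = (d%:R * k%:R - (i%:R + d%:R ^+ 2 * j%:R)) / (d%:R * k%:R)).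
  by rewrite divr_ge0 ?subr_ge0 // mulr_ge0.
by field; rewrite !gt_eqF.
Qed.

Lemma sel_varZ : sel 'X_iZ 0 0.
Proof.
have nz_Z : 'X_iZ != 0 :> {mpoly CC[3]} by rewrite -msize_poly_eq0 msizeX.
have [i [j selZ]] := sel_exists (dhomog_varXn CC iZ 1) nz_Z.
have := sel_expand selZ; rewrite expand_varZ pnatr_eq0 eqb0 negbK.
by move=> /andP[/eqP i0 /eqP j0]; rewrite i0 j0 in selZ.
Qed.

Lemma sel_curve : sel G 0 1.
Proof.
have [i [j selG]] := sel_exists homG nz_G.
have le_ij := sel_le homG nz_G selG.
have : (0 < j)%N.
  by rewrite lt0n; apply: contraNneq (sel_expand selG) => ->; rewrite Gxi.
case: j selG le_ij => // j selG le_ij _.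
have [i0 j0] : i = 0%N /\ j = 0%N by split; nia.
by rewrite i0 j0 in selG.
Qed.

Lemma sel_near_corner (e : RR) : 0 < e -> exists (k : nat) (F : {mpoly CC[3]}) (i j : nat),
  [/\ (0 < k)%N /\ F \is k.-homog, F != 0, sel F i j,
      `|d%:R - i%:R / k%:R| < e & `|0 - j%:R / k%:R| < e].
Proof.
move=> e_gt0; have [r r_gt0 lt_e] := archimedean_quotient d%:R e_gt0.
have [F [homF nz_F] F_corner] := corner_form_exists d_gt0 r_gt0 xi.
have [i [j selF]] := sel_exists homF nz_F; have le_ij := sel_le homF nz_F selF.
have [lt_jr lt_i] := F_corner _ _ le_ij (sel_expand selF).
have k_gt0 : (0 < d * (r + r ^ 2))%N by rewrite muln_gt0 d_gt0 addn_gt0 r_gt0.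
exists (d * (r + r ^ 2))%N, F, i, j; split=> //.
  have le_d : i%:R / (d * (r + r ^ 2))%:R <= d%:R :> RR.
    by rewrite ler_pdivrMr ?ltr0n // -natrM ler_nat (leq_trans _ le_ij) ?leq_addr.
  have ge_d : d%:R - d%:R / r.+1%:R <= i%:R / (d * (r + r ^ 2))%:R :> RR.
    rewrite ler_pdivlMr ?ltr0n // (_ : _ * _ = (d ^ 2 * r ^ 2)%:R).
      by rewrite ler_nat ltnW.
    by rewrite !natrM natrD !natrX -natr1; field; rewrite natr1 pnatr_eq0.
  by rewrite ger0_norm ?subr_ge0 // (le_lt_trans _ lt_e) // lerBlDl -lerBlDr.
rewrite sub0r normrN ger0_norm ?divr_ge0 // (le_lt_trans _ lt_e) //.
rewrite ler_pdivrMr ?ltr0n // mulrAC ler_pdivlMr ?ltr0n // -!natrM ler_nat.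
apply: leq_trans (leq_mul (ltnW lt_jr) (leqnn r.+1)) _.
by rewrite mulnS -[(r * r)%N]/(r ^ 2)%N mulnA leq_pmull // muln_gt0 d_gt0.
Qed.

Lemma index_body_triangle : seteq2 (index_body sel) (triangle d%:R 0 (1 / d%:R)).
Proof.
apply: closure_conv_hull_triangle d_gt0R (divr_gt0 ltr01 d_gt0R) _ _ _ _.
- move=> _ [k [F [i [j [k_gt0 [homF [nz_F [selF ->]]]]]]]].
  exact: scaled_index_in_triangle k_gt0 (sel_le homF nz_F selF).
- apply: sub_closure2; exists 1%N, 'X_iZ, 0%N, 0%N; rewrite !mul0r.
  do !split; first exact: dhomog_varXn 1.
    by rewrite -msize_poly_eq0 msizeX.
  exact: sel_varZ.
- move=> e /sel_near_corner[k [F [i [j [[k_gt0 homF] nz_F selF near1 near2]]]]].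
  by exists (i%:R / k%:R, j%:R / k%:R); split=> //; exists k, F, i, j.
- apply: sub_closure2; exists d, G, 0%N, 1%N; rewrite mul0r.
  by do !split=> //; exact: sel_curve.
Qed.

End IndexBody.

Lemma DeltaCs_index_body xi (s : rat) :
  seteq2 (DeltaCs xi s) (matimg 1 (ratr s) 0 1 (index_body (vplus_at xi s))).
Proof.
have vE (i j : nat) : ratr (i%:Q + s * j%:Q) = i%:R + ratr s * j%:R :> RR.
  by rewrite rmorphD rmorphM /= -!pmulrn !ratr_nat.
have nz_det : 1 * 1 - ratr s * 0 != 0 :> RR by rewrite mulr0 subr0 mulr1 oner_neq0.
move=> p; apply: iff_trans (closure_conv_hull_matimg _ nz_det p).
apply: eq_closure_conv_hull => {}p; split.
  move=> [k [F [i [j [k_gt0 [homF [nz_F [vF ->]]]]]]]].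
  exists (i%:R / k%:R, j%:R / k%:R); split; first by exists k, F, i, j.
  by rewrite /= vE; congr (_, _); ring.
move=> [_ [[k [F [i [j [k_gt0 [homF [nz_F [vF ->]]]]]]]] ->]].
exists k, F, i, j; do !split=> //=.
by rewrite vE; congr (_, _); ring.
Qed.

Lemma DeltaNO_index_body G xi :
  seteq2 (DeltaNO G xi) (matimg 0 1 1 0 (index_body (fun F i j => nu_at G xi F j i))).
Proof.
have nz_det : 0 * 0 - 1 * 1 != 0 :> RR by rewrite mulr0 sub0r mulr1 oppr_eq0 oner_neq0.
move=> p; apply: iff_trans (closure_conv_hull_matimg _ nz_det p).
apply: eq_closure_conv_hull => {}p; split.
  move=> [k [F [m [o [k_gt0 [homF [nz_F [nuF ->]]]]]]]].
  exists (o%:R / k%:R, m%:R / k%:R); split; first by exists k, F, o, m.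
  by rewrite /=; congr (_, _); ring.
move=> [_ [[k [F [o [m [k_gt0 [homF [nz_F [nuF ->]]]]]]]] ->]].
exists k, F, m, o; do !split=> //=.
by congr (_, _); ring.
Qed.

Section Bodies.
Variables (d : nat) (G : {mpoly CC[3]}) (xi : ps).
Hypotheses (d_gt0 : (0 < d)%N) (homG : G \is d.-homog) (irrG : mirreducible G)
  (GO : G.@[ptO] = 0) (dGO : (mderiv iY G).@[ptO] != 0)
  (xi0 : xi 0%N = 0) (Gxi : vanishes_on xi G).

Let nz_G := mirreducible_neq0 irrG.
Let nz_dR : d%:R != 0 :> RR. Proof. by rewrite pnatr_eq0 -lt0n. Qed.

Lemma DeltaCs_triangle (s : rat) : ((d ^ 2)%N)%:Q <= s ->
  seteq2 (DeltaCs xi s) (triangle d%:R (ratr s / d%:R) (1 / d%:R)).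
Proof.
move=> s_ge; have s_ge0 : 0 <= s by apply: le_trans s_ge; rewrite ler0n.
have bodyE : seteq2 (index_body (vplus_at xi s)) (triangle d%:R 0 (1 / d%:R)).
  apply: (index_body_triangle d_gt0 homG nz_G Gxi) => [k F homF nz_F|F i j []//|].
    have [m [o /(nu_at_flag_order Gxi dGO xi0)[_ [nz_Fom _]]]] :=
      nu_at_exists homG irrG GO Gxi d_gt0 homF nz_F.
    exact: vplus_at_exists s_ge0 nz_Fom.
  by move=> k F i j; exact (vplus_at_le homG irrG GO Gxi d_gt0 dGO xi0 s_ge).
move=> p; apply: iff_trans (DeltaCs_index_body xi s p) _.
apply: iff_trans (eq_matimg _ _ _ _ bodyE p) _.
by apply: matimg_triangle; congr (_, _); field.
Qed.

Lemma DeltaNO_triangle : seteq2 (DeltaNO G xi) (triangle (1 / d%:R) 0 d%:R).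
Proof.
have bodyE : seteq2 (index_body (fun F i j => nu_at G xi F j i))
    (triangle d%:R 0 (1 / d%:R)).
  apply: (index_body_triangle d_gt0 homG nz_G Gxi)
    => [k F homF nz_F|F i j|k F i j homF nz_F nuF].
  - by have [m [o nuF]] := nu_at_exists homG irrG GO Gxi d_gt0 homF nz_F; exists o, m.
  - by case/(nu_at_flag_order Gxi dGO xi0) => _ [].
  - exact (nu_at_le homG irrG GO Gxi homF nz_F nuF).
move=> p; apply: iff_trans (DeltaNO_index_body G xi p) _.
apply: iff_trans (eq_matimg _ _ _ _ bodyE p) (iff_trans _ (conv_hull_swap _ _ p)).
by apply: matimg_triangle; congr (_, _); field.
Qed.

End Bodies.

Lemma triangle_change_of_flag (d s : RR) : d != 0 ->
  seteq2 (matimg 0 1 1 (- s) (triangle d (s / d) (1 / d))) (triangle (1 / d) 0 d).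
Proof.
move=> nz_d p; apply: iff_trans (conv_hull_swap _ _ p).
by apply: matimg_triangle; congr (_, _); field.
Qed.

Theorem theorem5p11 (d : nat) (G : {mpoly CC[3]}) (xi : ps) :
  (0 < d)%N -> homog3 d G -> mirreducible G ->
  G.@[ptO] = 0 ->
  (mderiv iX G).@[ptO] = 0 -> (mderiv iY G).@[ptO] != 0 ->
  xi 0%N = 0 -> xi 1%N = 0 -> (forall i : nat, expand xi G i 0 = 0) ->
  forall s : rat, ((d ^ 2)%N)%:Q <= s ->
    seteq2 (DeltaCs xi s) (triangle d%:R (ratr s / d%:R) (1 / d%:R)) /\
    seteq2 (DeltaNO G xi) (triangle (1 / d%:R) 0 d%:R) /\
    seteq2 (DeltaNO G xi) (matimg 0 1 1 (- ratr s) (DeltaCs xi s)).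
Proof.
move=> d_gt0 homG irrG GO _ dGO xi0 _ Gxi s s_ge.
have CsE := DeltaCs_triangle d_gt0 homG irrG GO dGO xi0 Gxi s_ge.
have NOE := DeltaNO_triangle d_gt0 homG irrG GO dGO xi0 Gxi.
have nz_d : d%:R != 0 :> RR by rewrite pnatr_eq0 -lt0n.
split; [exact: CsE | split; [exact: NOE|]] => p.
apply: iff_trans (NOE p) (iff_sym _); apply: iff_trans (eq_matimg _ _ _ _ CsE p) _.
exact: triangle_change_of_flag.
Qed.
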